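(* Let $0<\ell\le n$ be integers. Let $h\in\mathbb Z$ and $\eta\in S\setminus\{0\}$ satisfy the following: (1) if $R$ is infinite, then $\mathrm N_{S/R}(\eta)\ne(-1)^{\ell n}$; (2) if $R$ is finite, then $\mathrm N_{\overline S/\overline R}(\overline\eta)\ne(-1)^{\ell n}$. Then the $R$-module $$\mathcal H_{\ell,\sigma}(\eta,h)=\left\{\sum_{i=0}^{\ell-1}f_i\sigma^i+\eta\,\sigma^h(f_0)\sigma^\ell : f_i\in S\right\}\subseteq S[G]$$ is an MRD code.
   Context: Setting: $G=\langle\sigma\rangle$ is a cyclic group of order $n$. A $G$-Galois extension is an extension $S/R$ of commutative rings such that $G$ is a subgroup of $\mathrm{Aut}(S/R)$ (automorphisms of $S$ as $R$-algebra), $S^G=R$, and the map $S\otimes_R S\to\bigoplus_{g\in G}S$, $x\otimes y\mapsto (xg(y))_{g\in G}$, is bijective. $S/R$ is an unramified $G$-Galois extension of local principal ideal rings, meaning: there is a $G$-Galois extension $\tilde S/\tilde R$ of discrete valuation rings and $\omega\in\tilde R$ such that $\tilde R\omega$ and $\tilde S\omega$ are the maximal ideals of $\tilde R$ and $\tilde S$, and either $R=\tilde R$, $S=\tilde S$, or $R=\tilde R/\tilde R\omega^k$, $S=\tilde S/\tilde S\omega^k$ for some $k\geq 1$, with $G$ acting on $S$ by the induced automorphisms; then $S/R$ is $G$-Galois and $S$ is a free $R$-module of rank $n$. $\overline R$ and $\overline S$ are the residue fields of $R$ and $S$, and the extension $\overline S/\overline R$ is $G$-Galois; $\overline R$ is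 assumed to be finite. Bars denote images in $\overline S$. The norm is $\mathrm N_{S/R}(a)=\prod_{g\in G}g(a)$ for $a\in S$, and similarly for $\overline S/\overline R$. $S[G]$ is the skew group algebra: the free $S$-module with basis $G$ and multiplication $(ag)(bh)=a\,g(b)\,gh$. It is identified with $\mathrm{End}_R(S)$ via $\sum_g a_g g\mapsto (x\mapsto\sum_g a_g g(x))$. For a finitely generated $R$-module $M$, $\mathrm{rk}_{\mathrm{inn}}(M,R)$ is the minimal number of generators of $M$; for $f\in S[G]$ viewed in $\mathrm{End}_R(S)$, $\mathrm{rk}_{\mathrm{inn}}(f,R)=\mathrm{rk}_{\mathrm{inn}}(f(S),R)$. The minimum rank distance of an $R$-linear code (a nonzero $R$-submodule) $\mathcal C\subseteq S[G]$ is $d(\mathcal C)=\min\{\mathrm{rk}_{\mathrm{inn}}(f,R): f\in\mathcal C\setminus\{0\}\}$. The code $\mathcal C$ is called MRD (maximum rank distance) if it is a free $R$-submodule of $S[G]$ with $\mathrm{rk}_{\mathrm{inn}}(\mathcal C,R)=n(n-d(\mathcal C)+1)$. *)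

(* Defs.v *)
From HB Require Import structures.
From mathcomp Require Import all_boot all_order all_algebra all_fingroup.
From mathcomp Require Import ring_quotient.
From mathcomp Require Import boolp classical_sets functions cardinality.

Set Implicit Arguments.
Unset Strict Implicit.
Unset Printing Implicit Defensive.

Import GRing.Theory.
Local Open Scope classical_set_scope.
Local Open Scope ring_scope.
Local Open Scope quotient_scope.

(** * Tensor products *)

(* The sequence [:: (x1, y1); ...; (xk, yk)] stands for the sum of the pure
   tensors xi (x) yi; [tensor_eq] is the congruence generated by the defining
   relations of M (x)_R N.  Negatives need no constructor of their own since
   - (x (x) y) = (- x) (x) y. *)
Inductive tensor_eq (R : pzRingType) (M N : lmodType R) :
    seq (M * N) -> seq (M * N) -> Prop :=
| Teq_refl s : tensor_eq s s
| Teq_sym s t : tensor_eq s t -> tensor_eq t s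
| Teq_trans s t u : tensor_eq s t -> tensor_eq t u -> tensor_eq s u
| Teq_cat s s' t t' :
    tensor_eq s s' -> tensor_eq t t' -> tensor_eq (s ++ t) (s' ++ t')
| Teq_comm s t : tensor_eq (s ++ t) (t ++ s)
| Teq_zero : tensor_eq [:: (0, 0)] [::]
| Teq_addl x x' y : tensor_eq [:: (x + x', y)] [:: (x, y); (x', y)]
| Teq_addr x y y' : tensor_eq [:: (x, y + y')] [:: (x, y); (x, y')]
| Teq_scale a x y : tensor_eq [:: (a *: x, y)] [:: (x, a *: y)].

Definition tensor_rel (R : pzRingType) (M N : lmodType R) :
  rel (seq (M * N)) := fun s t => `[< tensor_eq s t >].

Lemma tensor_rel_refl (R : pzRingType) (M N : lmodType R) :
  reflexive (@tensor_rel R M N).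
Proof. by move=> s; apply/asboolP; apply: Teq_refl. Qed.

Lemma tensor_rel_sym (R : pzRingType) (M N : lmodType R) :
  symmetric (@tensor_rel R M N).
Proof. by move=> s t; apply/asboolP/asboolP => /Teq_sym. Qed.

Lemma tensor_rel_trans (R : pzRingType) (M N : lmodType R) :
  transitive (@tensor_rel R M N).
Proof.
move=> t s u /asboolP st /asboolP tu.
by apply/asboolP; apply: Teq_trans st tu.
Qed.

Canonical tensor_equiv (R : pzRingType) (M N : lmodType R) :=
  EquivRel (@tensor_rel R M N) (@tensor_rel_refl R M N)
    (@tensor_rel_sym R M N) (@tensor_rel_trans R M N).

Definition tensor (R : pzRingType) (M N : lmodType R) : Type :=
  {eq_quot (tensor_equiv M N)}.

(** * Galois extensions *)

Section Galois.
Variables (gT : finGroupType) (R : comNzRingType) (S : comAlgType R).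
Variable act : gT -> {lrmorphism S -> S}.

(* gT is a subgroup of Aut(S/R): a faithful left action by R-algebra maps. *)
Definition is_aut_group : Prop :=
  [/\ forall x : S, act 1%g x = x,
      forall (g h : gT) (x : S), act (g * h)%g x = act g (act h x)
    & forall g : gT, (forall x : S, act g x = x) -> g = 1%g].

Definition galois_sum (s : seq (S * S)) : {ffun gT -> S} :=
  [ffun g => \sum_(p <- s) p.1 * act g p.2].

Definition galois_map (t : tensor S S) : {ffun gT -> S} :=
  galois_sum (generic_quotient.repr t).

Lemma galois_sum_eq (s t : seq (S * S)) :
  tensor_eq s t -> galois_sum s = galois_sum t.
Proof.
move=> st; apply/ffunP => g; rewrite !ffunE.
elim: st => {s t}.
- by [].
- by move=> s t _ ->.
- by move=> s t u _ -> _ ->.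
- by move=> s s' t t' _ es _ et; rewrite !big_cat /= es et.
- by move=> s t; rewrite !big_cat /= addrC.
- by rewrite big_seq1 big_nil mul0r.
- by move=> x x' y; rewrite !big_cons !big_nil /= !addr0 mulrDl.
- by move=> x y y'; rewrite !big_cons !big_nil /= !addr0 raddfD mulrDr.
- by move=> a x y; rewrite !big_seq1 /= linearZ /= -scalerAl -scalerAr.
Qed.

Lemma galois_map_pi (s : seq (S * S)) :
  galois_map (\pi_{eq_quot (tensor_equiv S S)} s) = galois_sum s.
Proof.
apply: galois_sum_eq; apply/asboolP.
have : generic_quotient.repr (\pi_{eq_quot (tensor_equiv S S)} s) == s
    %[mod {eq_quot (tensor_equiv S S)}] by rewrite reprK.
by rewrite eqmodE.
Qed.

Definition is_galois : Prop :=
  [/\ is_aut_group,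
      injective (fun a : R => a%:A : S),
      forall x : S, (forall g : gT, act g x = x) <-> exists a : R, x = a%:A
    & bijective galois_map].

Definition galois_norm (x : S) : S := \prod_(g : gT) act g x.

(* Evaluating s at a representative is independent of its choice when s is an
   automorphism and m is the maximal ideal of a local ring, as m is then stable
   under s. *)
Definition quot_map (m : idealr S) (s : S -> S) :
  {ideal_quot m} -> {ideal_quot m} :=
  fun x => \pi_{ideal_quot m} (s (generic_quotient.repr x)).

Definition residue_norm (m : idealr S) (x : {ideal_quot m}) : {ideal_quot m} :=
  \prod_(g : gT) quot_map (act g) x.

End Galois.

(** * Discrete valuation rings and unramified extensions *)

(* [idealr_closed] characterizes the proper ideals. *)
Definition is_maximal_ideal (A : comNzRingType) (I : {pred A}) : Prop :=
  idealr_closed I /\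
  forall J : {pred A}, idealr_closed J -> {subset I <= J} -> J =i I.

Definition principal (A : comNzRingType) (a : A) : {pred A} :=
  fun x => `[< exists b : A, x = b * a >].

Definition is_dvr (A : comNzRingType) : Prop :=
  [/\ forall x y : A, x * y = 0 -> x = 0 \/ y = 0,
      forall I : {pred A}, idealr_closed I -> exists a : A, I =i principal a,
      exists! I : {pred A}, is_maximal_ideal I
    & exists x : A, x != 0 /\ forall y : A, x * y <> 1].

(* R = Rt / ker pR and S = St / ker pS as gT-extensions, up to isomorphism. *)
Definition is_quotient_extension (gT : finGroupType)
    (Rt : comNzRingType) (St : comAlgType Rt) (actt : gT -> {lrmorphism St -> St})
    (R : comNzRingType) (S : comAlgType R) (act : gT -> {lrmorphism S -> S})
    (pR : {rmorphism Rt -> R}) (pS : {rmorphism St -> S})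
    (I : {pred Rt}) (J : {pred St}) : Prop :=
  [/\ (forall y : R, exists x : Rt, pR x = y) /\
        (forall x : Rt, pR x = 0 <-> x \in I),
      (forall y : S, exists x : St, pS x = y) /\
        (forall x : St, pS x = 0 <-> x \in J),
      forall a : Rt, pS a%:A = (pR a)%:A
    & forall (g : gT) (x : St), pS (actt g x) = act g (pS x)].

Definition is_unramified_galois (gT : finGroupType)
    (R : comNzRingType) (S : comAlgType R)
    (act : gT -> {lrmorphism S -> S}) : Prop :=
  exists (Rt : comNzRingType) (St : comAlgType Rt)
    (actt : gT -> {lrmorphism St -> St}) (w : Rt)
    (pR : {rmorphism Rt -> R}) (pS : {rmorphism St -> S}),
    [/\ is_dvr Rt /\ is_dvr St,
        is_galois actt,
        is_maximal_ideal (principal w),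
        is_maximal_ideal (principal (w%:A : St))
      & is_quotient_extension actt act pR pS
          (principal (0 : Rt)) (principal (0 : St)) \/
        exists2 k : nat, (0 < k)%N &
          is_quotient_extension actt act pR pS
            (principal (w ^+ k)) (principal ((w%:A : St) ^+ k))].

(** * Minimal number of generators *)

(* The least element of P; 0 if P is empty. *)
Definition min_nat (P : set nat) : nat :=
  xget 0%N [set k | P k /\ forall j : nat, P j -> (k <= j)%N].

Section Rank.
Variables (R : comNzRingType) (V : lmodType R).

Definition generates (k : nat) (b : 'I_k -> V) (M : set V) : Prop :=
  forall x : V, M x <-> exists c : 'I_k -> R, x = \sum_(i < k) c i *: b i.

Definition lin_indep (k : nat) (b : 'I_k -> V) : Prop :=
  forall c : 'I_k -> R,
    \sum_(i < k) c i *: b i = 0 -> forall i : 'I_k, c i = 0.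

Definition rk_inn (M : set V) : nat :=
  min_nat [set k | exists b : 'I_k -> V, generates b M].

Definition is_free (M : set V) : Prop :=
  exists (k : nat) (b : 'I_k -> V), generates b M /\ lin_indep b.

End Rank.

(** * Codes in the skew group algebra *)

Section Codes.
Variables (gT : finGroupType) (R : comNzRingType) (S : comAlgType R).
Variable act : gT -> {lrmorphism S -> S}.

(* The module underlying S[G]: f stands for \sum_g (f g) g. *)
Definition skew : lmodType R := {ffun gT -> S}.

(* The element a g of S[G]. *)
Definition skew_mono (a : S) (g : gT) : skew :=
  [ffun x => if x == g then a else 0].

Definition skew_end (f : skew) (x : S) : S :=
  \sum_(g : gT) (f : {ffun gT -> S}) g * act g x.

Definition rk_inn_skew (f : skew) : nat := rk_inn (range (skew_end f)).

Definition is_code (C : set skew) : Prop :=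
  submod_closed [in C] /\ exists2 f : skew, C f & f != 0.

Definition min_dist (C : set skew) : nat :=
  min_nat [set d | exists f : skew, [/\ C f, f != 0 & d = rk_inn_skew f]].

(* The truncated subtraction is harmless: if S is generated by #|gT| elements
   over R, then so is f(S), hence min_dist C <= #|gT|. *)
Definition is_MRD (C : set skew) : Prop :=
  [/\ is_code C, is_free C &
      rk_inn C = (#|gT| * (#|gT| - min_dist C + 1))%N].

Definition expgz (g : gT) (h : int) : gT :=
  match h with Posz m => (g ^+ m)%g | Negz m => (g ^- m.+1)%g end.

(* Only the values f 0, ..., f (l - 1) matter when 0 < l. *)
Definition twisted_code (s : gT) (l : nat) (eta : S) (h : int) : set skew :=
  [set u | exists f : nat -> S,
     u = \sum_(i < l) skew_mono (f i) (s ^+ i)%g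
         + skew_mono (eta * act (expgz s h) (f 0%N)) (s ^+ l)%g].

End Codes.

(* Main.v *)
Require Import Defs.
From HB Require Import structures.
From mathcomp Require Import all_boot all_order all_algebra all_fingroup.
From mathcomp Require Import cyclic ring_quotient.
From mathcomp Require Import boolp classical_sets functions cardinality.

Set Implicit Arguments.
Unset Strict Implicit.
Unset Printing Implicit Defensive.

Import GRing.Theory.
Local Open Scope classical_set_scope.
Local Open Scope ring_scope.
Local Open Scope quotient_scope.

(** Write f for the word with parameters f_0, ..., f_(l-1), viewed as the
    R-linear endomorphism sum_(i <= l) f_i s^i of S, where the last coefficient
    is f_l = eta s^h(f_0).  Everything follows from one bound: if some f_i with
    i < l is nonzero, then f(S) cannot be generated by n - l elements.  Indeed,
    as S is free of rank n over R, the bound makes the parametrization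
    injective, so the code is free of rank l n; and as the l n coefficients of
    a word can be chosen so that it kills l - 1 elements of a basis of S, the
    minimum distance is exactly n - l + 1 (MRD_of_rank_bound).

    The bound is first proved over a domain D with an automorphism of finite
    order (skew_poly_rank_bound).  If f(D) had n - l generators, then f would
    vanish on l elements u_1, ..., u_l that are independent over the fixed
    ring.  By Artin's argument the Moore determinant Delta = det(s^i(u_j)) is
    nonzero, and Cramer's rule gives f_0 Delta = (-1)^l f_l s(Delta).  Taking
    norms, with N(f_l) = N(eta) N(f_0), forces N(eta) = (-1)^(l n), unless
    f_0 = 0; but then f_l = 0 too, and f has too small a degree to vanish on
    the u_j.  When R is a discrete valuation ring, this applies to D = S.
    When R is a proper quotient, with uniformizer w, a nonzero f is
    w^j f' with f' nonzero modulo the maximal ideal, and relations between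
    values of f become relations between values of f' over the residue field,
    so the bound applies with D the residue field of S.  These are the two
    cases of the hypothesis on eta: a discrete valuation ring is infinite, and
    its proper quotients are finite as the residue field is.

    Linear algebra is done over arbitrary commutative rings: a matrix whose
    full-height minors all vanish has a nonzero left kernel (left_kernel).  This
    replaces ranks over fraction and residue fields, and also yields a basis
    of S: surjectivity of the map from the tensor square of S gives elements
    x_i, y_i with sum_i g(x_i) h(y_i) = (g == h), so that the matrix (g(x_i))
    has a right inverse, hence trivial left kernel modulo the maximal ideal,
    hence a full-height minor that is a unit; the x_i in that minor form a
    basis. *)

(** * Maximal minors over a commutative ring *)

(** McCoy's argument: bordering a maximal nonzero minor by one more row and
    expanding gives a left kernel vector, whose entry at the added row is the
    minor.  The kernel vectors of the various rows outside the minor are thus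
    in echelon form, hence independent over a domain.  The last clause holds
    since the entries are polynomials in those of M. *)
Lemma max_minor (A : comNzRingType) (m p : nat) (M : 'M[A]_(m, p)) :
  exists (t : nat) (f : 'I_t -> 'I_m) (g : 'I_t -> 'I_p),
  [/\ injective f, injective g, \det (mxsub f g M) != 0
    & forall i0, (forall k, f k != i0) -> exists v : 'rV[A]_m,
      [/\ v *m M = 0, v 0 i0 = \det (mxsub f g M),
          forall i, i != i0 -> (forall k, f k != i) -> v 0 i = 0
        & forall phi : {rmorphism A -> A},
            map_mx phi M = M -> map_mx phi v = v]].
Proof.
pose P t := `[< exists (f : 'I_t -> 'I_m) (g : 'I_t -> 'I_p),
  \det (mxsub f g M) != 0 >].
have injg t (f : 'I_t -> 'I_m) (g : 'I_t -> 'I_p) :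
    \det (mxsub f g M) != 0 -> injective g.
  move=> d0 i j gij; apply/eqP; apply: contraNT d0 => ij.
  rewrite -det_tr (determinant_alternate ij) // => k.
  by rewrite !mxE gij.
have injf t (f : 'I_t -> 'I_m) (g : 'I_t -> 'I_p) :
    \det (mxsub f g M) != 0 -> injective f.
  move=> d0 i j fij; apply/eqP; apply: contraNT d0 => ij.
  by rewrite (determinant_alternate ij) // => k; rewrite !mxE fij.
have P0 : exists t, P t.
  have F k : 'I_0 -> 'I_k by case.
  by exists 0%N; apply/asboolP; exists (F m), (F p); rewrite det_mx00 oner_eq0.
have Pp t : P t -> (t <= p)%N.
  move=> /asboolP [f [g /injg gI]].
  by have := max_card [in codom g]; rewrite card_codom // !card_ord.
case: (ex_maxnP P0 Pp) => t /asboolP [f [g d0]] tmax.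
exists t, f, g; split; rewrite ?d0 //; [exact: injf d0|exact: injg d0|].
move=> i0 fi0.
(* Border the minor by row i0 and column j: the result vanishes, as a larger
   minor, and expanding it along column j gives coefficients that do not
   depend on j. *)
pose f' (k : 'I_(1 + t)) := if unlift ord0 k is Some k' then f k' else i0.
pose g' j (k : 'I_(1 + t)) := if unlift ord0 k is Some k' then g k' else j.
have bord0 j : \det (mxsub f' (g' j) M) = 0.
  apply/eqP; apply: contraT => d1.
  have /tmax : P t.+1 by apply/asboolP; exists f', (g' j).
  by rewrite ltnn.
pose cof (k : 'I_(1 + t)) : A :=
  (-1) ^+ (k + @ord0 t) * \det (mxsub (fun l => f' (lift k l)) g M).
have bordE j : \sum_k cof k * M (f' k) j = 0.
  rewrite -[RHS](bord0 j) (expand_det_col _ ord0); apply: eq_bigr => k _.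
  rewrite mulrC !mxE /g' unlift_none /cofactor; congr (_ * (_ * \det _)).
  by apply/matrixP => a b; rewrite !mxE liftK.
have f'0 : f' ord0 = i0 by rewrite /f' unlift_none.
have f'S k : f' (lift ord0 k) = f k by rewrite /f' liftK.
pose v : 'rV[A]_m := \row_i \sum_(k | f' k == i) cof k.
have cof0 : cof ord0 = \det (mxsub f g M).
  rewrite /cof expr0 mul1r; congr (\det _).
  by apply/matrixP => a b; rewrite !mxE f'S.
exists v; split.
- apply/rowP => j; rewrite !mxE -[RHS](bordE j).
  rewrite (partition_big f' predT) //=; apply: eq_bigr => i _.
  rewrite mxE mulr_suml; apply: eq_bigr => k /eqP ->; exact: erefl.
- rewrite mxE -cof0 (bigD1 ord0) /= ?f'0 //= big1 ?addr0 // => k.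
  case: (unliftP ord0 k) => [k' ->|->]; last by rewrite andbF.
  by rewrite f'S (negPf (fi0 k')).
- move=> i ii0 fi; rewrite mxE big1 // => k.
  case: (unliftP ord0 k) => [k' ->|->]; first by rewrite f'S (negPf (fi k')).
  by rewrite f'0 eq_sym (negPf ii0).
- move=> phi phiM; apply/rowP => i; rewrite !mxE rmorph_sum /=.
  apply: eq_bigr => k _; rewrite rmorphM rmorphXn rmorphN1 /=.
  rewrite -det_map_mx map_mxsub phiM; exact: erefl.
Qed.

(** If all rows took part in a maximal nonzero minor, it would be a full minor
    up to a permutation of the rows. *)
Lemma left_kernel (A : comNzRingType) (m p : nat) (M : 'M[A]_(m, p)) :
  (forall g : 'I_m -> 'I_p, \det (colsub g M) = 0) ->
  exists2 v : 'rV[A]_m, v != 0 & v *m M = 0.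
Proof.
move=> det0; have [t [f [g [fI gI d0 ker]]]] := max_minor M.
have [[i0 fi0]|] := pselect (exists i0, forall k, f k != i0).
  have [v [vM vi0 _ _]] := ker i0 fi0; exists v => //.
  by apply: contraNneq d0 => v0; rewrite -vi0 v0 mxE.
move=> /forallNP surj; exfalso.
have tm : t = m.
  apply/eqP; rewrite eqn_leq; have := max_card [in codom f].
  rewrite card_codom // !card_ord => -> /=.
  rewrite -[leqRHS](card_ord t) -(card_codom fI) -[leqLHS]card_ord.
  apply: subset_leq_card; apply/fintype.subsetP => i _; apply/codomP.
  by have /existsNP[k /negP/negPn/eqP <-] := surj i; exists k.
subst t; move/negP: d0; apply.
have -> : mxsub f g M = row_perm (perm fI) (colsub g M).
  by apply/matrixP => i j; rewrite !mxE permE.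
by rewrite row_permE det_mulmx det0 mulr0.
Qed.

Lemma left_kernel_wide (A : comNzRingType) (m p : nat) (M : 'M[A]_(m, p)) :
  (p < m)%N -> exists2 v : 'rV[A]_m, v != 0 & v *m M = 0.
Proof.
move=> pm; apply: left_kernel => g; apply/eqP; apply: contraT => d0.
suff gI : injective g.
  by have := max_card [in codom g]; rewrite card_codom // !card_ord leqNgt pm.
move=> i j gij; apply/eqP; apply: contraNT d0 => ij.
rewrite -det_tr (determinant_alternate ij) // => k.
by rewrite !mxE gij.
Qed.

Lemma left_kernel_det0 (A : comNzRingType) (m : nat) (M : 'M[A]_m) :
  \det M = 0 -> exists2 v : 'rV[A]_m, v != 0 & v *m M = 0.
Proof.
move=> det0; apply: left_kernel => g.
have -> : colsub g M = M *m colsub g 1%:M.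
  by rewrite -[in LHS](mulmx1 M) mulmx_colsub.
by rewrite det_mulmx det0 mul0r.
Qed.

(** * Moore determinants over a domain with a cyclic group of automorphisms *)

Section CyclicDomain.
Variables (D : comNzRingType) (sg : {rmorphism D -> D}) (n : nat).
Hypothesis domD : forall x y : D, x * y = 0 -> x = 0 \/ y = 0.
Hypothesis n_gt0 : (0 < n)%N.
Hypothesis sgn : forall x, iter n sg x = x.

Definition cyc_norm (x : D) : D := \prod_(i < n) iter i sg x.

Definition indep_over_fixed (T : finType) (u : T -> D) : Prop :=
  forall c : T -> D, (forall j, sg (c j) = c j) ->
    \sum_j c j * u j = 0 -> forall j, c j = 0.

Let dom_mulI (x y z : D) : x != 0 -> x * y = x * z -> y = z.
Proof.
move=> /eqP x0 xyz; apply/eqP; rewrite -subr_eq0; apply/eqP.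
by case: (@domD x (y - z)) => //; rewrite mulrBr xyz subrr.
Qed.

Let iter_sg0 i : iter i sg 0 = 0.
Proof. by elim: i => //= i ->; rewrite rmorph0. Qed.

Let sg_eq0 x : sg x = 0 -> x = 0.
Proof. by move=> sx; rewrite -(sgn x) -(prednK n_gt0) iterSr sx iter_sg0. Qed.

Let iter_sg_eq0 i x : iter i sg x = 0 -> x = 0.
Proof. by elim: i => //= i IH /sg_eq0. Qed.

Let iter_sgM i : {morph iter i sg : x y / x * y}.
Proof. by move=> x y; elim: i => //= i ->; rewrite rmorphM. Qed.

Let iter_sg_sum i (T : finType) (F : T -> D) :
  iter i sg (\sum_j F j) = \sum_j iter i sg (F j).
Proof. by elim: i => //= i ->; rewrite rmorph_sum. Qed.

Lemma cyc_normM x y : cyc_norm (x * y) = cyc_norm x * cyc_norm y.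
Proof. by rewrite -big_split; apply: eq_bigr => i _; rewrite iter_sgM. Qed.

Lemma cyc_norm_fixed x : sg x = x -> cyc_norm x = x ^+ n.
Proof.
move=> sx; rewrite -[in RHS](card_ord n) -prodr_const.
by apply: eq_bigr => i _; elim: (val i) => //= k ->.
Qed.

Lemma sg_cyc_norm x : sg (cyc_norm x) = cyc_norm x.
Proof.
have := sgn x; rewrite /cyc_norm; case: n n_gt0 => // n' _ sgnx.
rewrite rmorph_prod big_ord_recr big_ord_recl mulrC /= -iterS sgnx.
by congr (_ * _).
Qed.

Lemma cyc_norm_eq0 x : cyc_norm x = 0 -> x = 0.
Proof.
rewrite /cyc_norm; elim: (n) => [|m IH].
  by rewrite big_ord0 => /eqP; rewrite oner_eq0.
by rewrite big_ord_recr => /domD [//|/iter_sg_eq0].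
Qed.

(** Artin's argument on the independence of characters.  Combining a relation
    with its image under sg removes the index k from its support at the price
    of one equation, so it can go on while there are at least as many
    equations as nonzero coefficients.  It stops when the ratios of the
    coefficients are fixed by sg.  The offset p counts the equations lost. *)
Lemma artin_descent (T : finType) (u : T -> D) (m p : nat) (c : T -> D) :
  (#|[pred j | c j != 0%R]| <= m)%N ->
  (forall i, (i < m)%N -> \sum_j c j * iter (p + i) sg (u j) = 0) ->
  (exists k, c k != 0) -> ~ indep_over_fixed u.
Proof.
elim: m p c => [|m IH] p c supp rel [k ck] uI.
  by move: supp; rewrite leqn0 => /eqP /card0_eq /(_ k); rewrite inE ck.
pose d j := c k * sg (c j) - sg (c k) * c j.
have [dn0|] := pselect (exists j, d j != 0).
  apply: (IH p.+1 d _ _ dn0 uI).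
    rewrite -ltnS; apply: leq_trans supp; apply: proper_card.
    apply/properP; split; last first.
      by exists k; rewrite !inE // /d mulrC subrr eqxx.
    apply/fintype.subsetP => j; rewrite !inE /d; apply: contraNneq => ->.
    by rewrite rmorph0 !mulr0 subr0.
  move=> i im; under eq_bigr => j _ do rewrite mulrBl -!mulrA.
  rewrite sumrB -!mulr_sumr addSnnS rel // mulr0 subr0.
  have -> : \sum_j sg (c j) * iter (p + i.+1) sg (u j)
      = sg (\sum_j c j * iter (p + i) sg (u j)).
    by rewrite rmorph_sum; apply: eq_bigr => j _; rewrite addnS rmorphM.
  by rewrite rel ?rmorph0 ?mulr0 // ltnW.
move=> /forallNP d0.
(* The ratios c j / c k are fixed; clear denominators with the other factors
   of the norm of c k. *)
pose q := \prod_(i < n.-1) iter i.+1 sg (c k).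
have qE : c k * q = cyc_norm (c k).
  by rewrite /cyc_norm -(prednK n_gt0) big_ord_recl.
have q0 : q != 0.
  by apply: contraNneq ck => q0; apply/eqP/cyc_norm_eq0; rewrite -qE q0 mulr0.
have fixed j : sg (c j * q) = c j * q.
  apply: (dom_mulI ck); rewrite rmorphM mulrA.
  have /negP/negPn := d0 j; rewrite subr_eq0 => /eqP ->.
  by rewrite mulrAC -rmorphM qE sg_cyc_norm -qE [RHS]mulrCA mulrC.
have rel0 : \sum_j (c j * q) * u j = 0.
  apply: (@iter_sg_eq0 p); rewrite iter_sg_sum.
  have iter_fixed j : iter p sg (c j * q) = c j * q.
    by elim: (p) => //= a ->.
  under eq_bigr => j _ do rewrite iter_sgM iter_fixed mulrAC.
  have := rel 0%N isT; rewrite addn0 -mulr_suml => ->.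
  by rewrite mul0r.
have := uI _ fixed rel0 k; rewrite qE => /cyc_norm_eq0 ck0.
by rewrite ck0 eqxx in ck.
Qed.

Definition moore m (u : 'I_m -> D) : 'M[D]_m :=
  \matrix_(i < m, j < m) iter i sg (u j).

Lemma moore_det_neq0 m (u : 'I_m -> D) :
  indep_over_fixed u -> \det (moore u) != 0.
Proof.
move=> uI; apply/eqP; rewrite -det_tr => /left_kernel_det0 [v v0 vM].
apply: (@artin_descent _ u m 0 (v 0)) uI.
- by rewrite -[leqRHS]card_ord max_card.
- move=> i im; have /rowP /(_ (Ordinal im)) := vM; rewrite !mxE => vM0.
  by rewrite -[RHS]vM0; apply: eq_bigr => j _; rewrite !mxE add0n.
- apply: contrapT => /forallNP v00; move/eqP: v0; apply.
  apply/rowP => j; rewrite mxE; apply/eqP.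
  by have /negP/negPn := v00 j.
Qed.

(** The equations determine f 0 from f q.+1 by Cramer's rule.  The minors that
    occur, which omit row 0 of the Moore matrix, are also the minors that omit
    the last row of its image under sg. *)
Lemma moore_cramer q (u : 'I_q.+1 -> D) (f : nat -> D) :
  (forall k, \sum_(i < q.+2) f i * iter i sg (u k) = 0) ->
  f 0%N * \det (moore u) = (-1) ^+ q.+1 * f q.+1 * sg (\det (moore u)).
Proof.
move=> fu; set M := moore u.
pose a : 'rV[D]_q.+1 := \row_i f i.
have aM : a *m M = - (f q.+1 *: \row_k iter q.+1 sg (u k)).
  apply/rowP => k; rewrite !mxE.
  apply/eqP; rewrite -addr_eq0; apply/eqP; rewrite -[RHS](fu k).
  rewrite [RHS]big_ord_recr; congr (_ + _).
  by apply: eq_bigr => i _; rewrite !mxE.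
have /rowP /(_ ord0) : a *m M *m \adj M = \det M *: a.
  by rewrite -mulmxA mul_mx_adj mul_mx_scalar.
have cofE k : cofactor M ord0 k
    = (-1) ^+ q * cofactor (map_mx sg M) ord_max k.
  rewrite /cofactor /= add0n mulrA -exprD addnA addnn -mul2n exprD exprM.
  rewrite sqrrN !expr1n mul1r; congr (_ * \det _).
  apply/matrixP => i j; rewrite !mxE -iterS.
  by rewrite /= /bump leqNgt ltn_ord.
rewrite aM mulNmx -scalemxAl !mxE => adjE.
rewrite [LHS]mulrC -[LHS]adjE {adjE}.
rewrite -det_map_mx (expand_det_row _ ord_max).
rewrite -mulrA exprS mulN1r mulNr; congr (- _).
rewrite mulrCA; congr (_ * _); rewrite mulr_sumr.
apply: eq_bigr => k _; rewrite [\adj M _ _]mxE cofE !mxE -iterS.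
by rewrite mulrCA.
Qed.

(** The vector (f 0, ..., f l) stands for a skew polynomial whose constant and
    leading coefficients are tied by f l = eta * t with N(t) = N(f 0).  The
    values at the b j being combinations of r elements, with fixed
    coefficients, the relations between the rows of A give at least n - r
    independent elements killed by f. *)
Lemma skew_poly_rank_bound (b : 'I_n -> D) (l r : nat) (f : nat -> D)
    (eta t : D) (A : 'M[D]_(n, r)) (v : 'I_r -> D) :
  indep_over_fixed b -> (0 < l)%N -> (r + l <= n)%N ->
  (exists2 i, (i < l)%N & f i != 0) ->
  f l = eta * t -> cyc_norm t = cyc_norm (f 0%N) ->
  cyc_norm eta <> (-1) ^+ (l * n) ->
  (forall i j, sg (A i j) = A i j) ->
  ~ (forall j, \sum_(i < l.+1) f i * iter i sg (b j) = \sum_k A j k * v k).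
Proof.
case: l => // q bI _ rl [i0 i0l fi0] fl Nt Neta Afix fb.
have [m [g [h [gI hI mu0 ker]]]] := max_minor A.
(* At least q.+1 rows of A lie outside a maximal minor; each gives a kernel
   vector whose entries at the other such rows vanish. *)
pose J := [set i | i \notin codom g]%SET.
have cJ : (q.+1 <= #|J|)%N.
  have := cardC (mem (codom g)); rewrite card_codom // !card_ord.
  have : (m <= r)%N.
    by have := max_card [in codom h]; rewrite card_codom // !card_ord.
  move=> mr cE; rewrite -(leq_add2l r) (leq_trans rl) //.
  suff : (m + #|[predC codom g]| <= r + #|J|)%N by rewrite cE.
  rewrite leq_add // subset_leq_card //; apply/fintype.subsetP => i.
  by rewrite !inE.
pose row k : 'I_n := enum_val (widen_ord cJ k).
have rowJ k : forall x, g x != row k.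
  move=> x; have kJ : row k \notin codom g.
    by have := enum_valP (widen_ord cJ k); rewrite inE.
  by apply: contraNneq kJ => <-; rewrite codom_f.
have rowI : injective row by move=> x y /enum_val_inj /(congr1 val) /= /ord_inj.
have /fin_all_exists [V VP] : forall k, exists w : 'rV[D]_n,
  [/\ w *m A = 0, w 0 (row k) = \det (mxsub g h A),
      forall k', k' != k -> w 0 (row k') = 0 & forall j, sg (w 0 j) = w 0 j].
  move=> k; have [w [wA wk w0 wfix]] := ker (row k) (rowJ k).
  exists w; split => //.
    by move=> k' kk; apply: w0; [rewrite (inj_eq rowI)|exact: rowJ].
  move=> j; rewrite -[in RHS](wfix sg) ?mxE //.
  by apply/matrixP => x y; rewrite mxE Afix.
pose u k := \sum_j V k 0 j * b j.
have uI : indep_over_fixed u.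
  move=> c cfix cu k.
  have cV : forall j, \sum_k c k * V k 0 j = 0.
    apply: bI => [j|].
      rewrite rmorph_sum; apply: eq_bigr => k' _.
      by rewrite rmorphM cfix; case: (VP k') => _ _ _ ->.
    rewrite -[RHS]cu; under [RHS]eq_bigr => k' _ do rewrite mulr_sumr.
    rewrite exchange_big; apply: eq_bigr => j _ /=.
    by rewrite mulr_suml; apply: eq_bigr => k' _; rewrite mulrA.
  have := cV (row k); rewrite (bigD1 k) //= big1 ?addr0; last first.
    by move=> k' kk; case: (VP k') => _ _ -> //; rewrite ?mulr0 // eq_sym.
  case: (VP k) => _ -> _ _ /domD [//|] /eqP; by rewrite (negPf mu0).
have fu k : \sum_(i < q.+2) f i * iter i sg (u k) = 0.
  have Vit i j : iter i sg (V k 0 j) = V k 0 j.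
    by elim: i => //= i ->; case: (VP k) => _ _ _ ->.
  under eq_bigr => i _ do rewrite iter_sg_sum mulr_sumr.
  rewrite exchange_big /=.
  transitivity (\sum_j V k 0 j * \sum_x A j x * v x).
    apply: eq_bigr => j _; rewrite -fb mulr_sumr; apply: eq_bigr => i _.
    by rewrite iter_sgM Vit mulrCA.
  under eq_bigr => j _ do rewrite mulr_sumr.
  rewrite exchange_big big1 //= => x _.
  under eq_bigr => j _ do rewrite mulrA.
  rewrite -mulr_suml; case: (VP k) => /rowP /(_ x); rewrite !mxE => -> _ _ _.
  by rewrite mul0r.
have det0 := moore_det_neq0 uI.
have [f00|f00] := eqVneq (f 0%N) 0.
  have t0 : t = 0.
    apply: cyc_norm_eq0; rewrite Nt f00 /cyc_norm.
    by rewrite -(prednK n_gt0) big_ord_recl /= mul0r.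
  have aM : (\row_(i < q.+1) f i) *m moore u = 0.
    apply/rowP => k; rewrite !mxE -[RHS](fu k) [RHS]big_ord_recr /=.
    rewrite fl t0 mulr0 mul0r addr0; apply: eq_bigr => i _; by rewrite !mxE.
  have : \det (moore u) *: (\row_(i < q.+1) f i) = 0.
    by rewrite -mul_mx_scalar -mul_mx_adj mulmxA aM mul0mx.
  move=> /rowP /(_ (Ordinal i0l)); rewrite !mxE /= => /domD [] /eqP.
    by rewrite (negPf det0).
  by rewrite (negPf fi0).
have := congr1 cyc_norm (moore_cramer fu).
have NsE x : cyc_norm (sg x) = cyc_norm x.
  rewrite -[RHS]sg_cyc_norm /cyc_norm rmorph_prod.
  by apply: eq_bigr => i _; rewrite -iterS -iterSr.
have N1 : cyc_norm ((-1) ^+ q.+1) = (-1) ^+ (q.+1 * n).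
  by rewrite cyc_norm_fixed -?exprM // rmorphXn rmorphN1.
rewrite fl !cyc_normM NsE Nt N1 => NE.
have Nf0 : cyc_norm (f 0%N) * cyc_norm (\det (moore u)) != 0.
  rewrite -cyc_normM; apply/eqP => /cyc_norm_eq0 /domD [] /eqP.
    by rewrite (negPf f00).
  by rewrite (negPf det0).
have := dom_mulI (y := 1) (z := (-1) ^+ (q.+1 * n) * cyc_norm eta) Nf0.
rewrite mulr1 => /(_ _) signE; apply: Neta.
rewrite -[RHS]mulr1 [X in _ = _ * X]signE; last first.
  by rewrite [LHS]NE [RHS]mulrC -!mulrA.
by rewrite mulrA -exprD addnn -mul2n exprM sqrrN !expr1n mul1r.
Qed.

End CyclicDomain.

(** * Generators and free modules *)

Lemma min_nat_eq (P : set nat) (k : nat) :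
  P k -> (forall j, P j -> (k <= j)%N) -> min_nat P = k.
Proof.
move=> Pk kmin; apply: xget_unique; first by split.
move=> j [Pj jmin]; apply/eqP.
by rewrite eqn_leq jmin // kmin.
Qed.

Lemma min_natP (P : set nat) :
  (exists k, P k) ->
  P (min_nat P) /\ forall j, P j -> (min_nat P <= j)%N.
Proof.
move=> [k0 Pk0].
have exP : exists k, `[< P k >] by exists k0; apply/asboolP.
case: (ex_minnP exP) => k /asboolP Pk kmin.
have -> : min_nat P = k.
  by apply: min_nat_eq => // j Pj; apply: kmin; apply/asboolP.
by split => // j Pj; apply: kmin; apply/asboolP.
Qed.

Section FreeModules.
Variables (R : comNzRingType) (V : lmodType R).

Lemma generates_mem k (b : 'I_k -> V) M i : generates b M -> M (b i).
Proof.
move=> bM; apply/bM; exists (fun j => (j == i)%:R).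
rewrite (bigD1 i) //= eqxx scale1r big1 ?addr0 // => j /negPf ->.
by rewrite scale0r.
Qed.

(** Fewer than k generators would express the basis through a matrix with a
    nonzero left kernel, which is a relation between the basis elements. *)
Lemma rk_inn_free k (b : 'I_k -> V) M :
  generates b M -> lin_indep b -> rk_inn M = k.
Proof.
move=> bM bI; apply: min_nat_eq; first by exists b.
move=> j [b' b'M]; rewrite leqNgt; apply/negP => jk.
have /fin_all_exists [P PE] i : exists c : 'I_j -> R, b i = \sum_q c q *: b' q.
  by apply/b'M; apply: generates_mem bM.
have [v v0 vP] := left_kernel_wide (\matrix_(i, q) P i q) jk.
move/eqP: v0; apply; apply/rowP => i; rewrite mxE.
apply: (bI (v 0)); under eq_bigr => i' _ do rewrite PE scaler_sumr.
rewrite exchange_big big1 //= => q _.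
under eq_bigr => i' _ do rewrite scalerA.
rewrite -scaler_suml; have /rowP /(_ q) := vP; rewrite !mxE.
by under eq_bigr => i' _ do rewrite mxE; move=> ->; rewrite scale0r.
Qed.

Lemma sum_enum_val (T : finType) (F : T -> V) :
  \sum_t F t = \sum_(i < #|T|) F (enum_val i).
Proof. by rewrite (reindex (@enum_val T T)) //=; apply/onW_bij/enum_val_bij. Qed.

End FreeModules.

(** * The parametrization of the code *)

Section Code.
Variables (gT : finGroupType) (s : gT) (R : comNzRingType) (S : comAlgType R).
Variable act : gT -> {lrmorphism S -> S}.
Variables (l : nat) (eta : S) (h : int).

Definition code_word (f : nat -> S) : Defs.skew gT S :=
  \sum_(i < l) skew_mono (f i) (s ^+ i)%g
  + skew_mono (eta * act (expgz s h) (f 0%N)) (s ^+ l)%g.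

Lemma skew_monoP a x y (g : gT) :
  skew_mono (a *: x + y) g = a *: skew_mono x g + skew_mono y g :> Defs.skew gT S.
Proof.
by apply/ffunP => k; rewrite !ffunE; case: eqP => // _; rewrite scaler0 addr0.
Qed.

Lemma code_wordP a f f' :
  code_word (fun i => a *: f i + f' i) = a *: code_word f + code_word f'.
Proof.
rewrite /code_word linearP mulrDr -scalerAr skew_monoP.
under eq_bigr => i _ do rewrite skew_monoP.
rewrite big_split /= -scaler_sumr scalerDr -!addrA; congr (_ + _).
by rewrite addrCA.
Qed.

Lemma code_word0 : code_word (fun=> 0) = 0.
Proof.
rewrite -[RHS](addNr (code_word (fun=> 0))) -scaleN1r -code_wordP.
congr code_word.
by apply: funext => i; rewrite scaler0 addr0.
Qed.

Lemma code_word_sum (T : Type) (r : seq T) (c : T -> R) (F : T -> nat -> S) :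
  code_word (fun i => \sum_(t <- r) c t *: F t i)
  = \sum_(t <- r) c t *: code_word (F t).
Proof.
elim: r => [|t r IH].
  rewrite big_nil -code_word0; congr code_word.
  by apply: funext => i; rewrite big_nil.
rewrite big_cons -IH -code_wordP; congr code_word.
by apply: funext => i; rewrite big_cons.
Qed.

Lemma eq_code_word f f' : (0 < l)%N ->
  (forall i, (i < l)%N -> f i = f' i) -> code_word f = code_word f'.
Proof.
move=> l0 ff; rewrite /code_word (ff 0%N l0); congr (_ + _).
by apply: eq_bigr => i _; rewrite ff.
Qed.

Lemma skew_endP a (u v : Defs.skew gT S) x :
  skew_end act (a *: u + v) x = a *: skew_end act u x + skew_end act v x.
Proof.
rewrite /skew_end scaler_sumr -big_split; apply: eq_bigr => g _.
by rewrite !ffunE mulrDl scalerAl.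
Qed.

Lemma skew_endPr a (u : Defs.skew gT S) x y :
  skew_end act u (a *: x + y) = a *: skew_end act u x + skew_end act u y.
Proof.
rewrite /skew_end scaler_sumr -big_split; apply: eq_bigr => g _.
by rewrite linearP mulrDr scalerAr.
Qed.

Lemma skew_end0 x : skew_end act (0 : Defs.skew gT S) x = 0.
Proof. by rewrite /skew_end big1 // => g _; rewrite ffunE mul0r. Qed.

Lemma skew_endr0 (u : Defs.skew gT S) : skew_end act u 0 = 0.
Proof. by rewrite /skew_end big1 // => g _; rewrite linear0 mulr0. Qed.

Lemma skew_end_suml (T : Type) (r : seq T) (c : T -> R) (F : T -> Defs.skew gT S) x :
  skew_end act (\sum_(t <- r) c t *: F t) x
  = \sum_(t <- r) c t *: skew_end act (F t) x.
Proof.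
elim: r => [|t r IH]; first by rewrite !big_nil skew_end0.
by rewrite !big_cons skew_endP IH.
Qed.

Lemma skew_end_sumr (T : Type) (r : seq T) (c : T -> R) (u : Defs.skew gT S) F :
  skew_end act u (\sum_(t <- r) c t *: F t)
  = \sum_(t <- r) c t *: skew_end act u (F t).
Proof.
elim: r => [|t r IH]; first by rewrite !big_nil skew_endr0.
by rewrite !big_cons skew_endPr IH.
Qed.

Lemma skew_end_mono a (g : gT) x :
  skew_end act (skew_mono a g : Defs.skew gT S) x = a * act g x.
Proof.
rewrite /skew_end (bigD1 g) //= ffunE eqxx big1 ?addr0 // => k /negPf kg.
by rewrite ffunE kg mul0r.
Qed.

Lemma skew_end_code_word f x :
  skew_end act (code_word f) x = \sum_(i < l) f i * act (s ^+ i)%g x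
    + eta * act (expgz s h) (f 0%N) * act (s ^+ l)%g x.
Proof.
have := skew_endP 1 (\sum_(i < l) skew_mono (f i) (s ^+ i)%g)
  (skew_mono (eta * act (expgz s h) (f 0%N)) (s ^+ l)%g : Defs.skew gT S) x.
rewrite !scale1r => ->; rewrite skew_end_mono; congr (_ + _).
have := skew_end_suml (index_enum 'I_l) (fun=> 1)
  (fun i : 'I_l => skew_mono (f i) (s ^+ i)%g : Defs.skew gT S) x.
under eq_bigr => i _ do rewrite scale1r.
move=> ->; apply: eq_bigr => i _; rewrite scale1r; exact: skew_end_mono.
Qed.

(** * Codes whose words have large rank *)

(** Once S is free of rank n and every word with a nonzero parameter has a
    range that fewer than n - l + 1 elements cannot generate, the
    parametrization is injective, and the code is free of rank l n.  The
    distance is attained since the l n coefficients can be chosen to make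
    a word vanish on l - 1 basis elements. *)
Lemma MRD_of_rank_bound n (b : 'I_n -> S) :
  #|gT| = n -> (0 < l <= n)%N ->
  (forall x : S, exists c : 'I_n -> R, x = \sum_j c j *: b j) -> lin_indep b ->
  (forall f r (v : 'I_r -> S), (exists2 i, (i < l)%N & f i != 0) ->
    generates v (range (skew_end act (code_word f))) -> (n < r + l)%N) ->
  is_MRD act (twisted_code act s l eta h).
Proof.
move=> gTn /andP [l0 ln] bS bI key.
pose C := twisted_code act s l eta h.
(* A word equal to zero has a range with no generators, against the bound. *)
have inj f : code_word f = 0 -> forall i, (i < l)%N -> f i = 0.
  move=> f0 i il; apply/eqP; apply: contraT => fi.
  have := key f 0%N (fun=> 0); rewrite add0n ltnNge ln; apply; first by exists i.
  move=> x; split => [[y _ <-]|[c ->]].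
    by exists (fun=> 0); rewrite f0 skew_end0 big_ord0.
  by exists 0 => //; rewrite skew_endr0 big_ord0.
have /choice [coord coordE] := bS.
pose T := ('I_l * 'I_n)%type.
pose par (t : T) (i : nat) := if i == t.1 then b t.2 else 0.
pose e t := code_word (par t).
have sum_par (c : T -> R) (i : 'I_l) :
    \sum_t c t *: par t i = \sum_j c (i, j) *: b j.
  rewrite (eq_bigr (fun t => c (t.1, t.2) *: par (t.1, t.2) i)); last by case.
  rewrite -(pair_bigA _ (fun i' j => c (i', j) *: par (i', j) i)) (bigD1 i) //=.
  rewrite [X in _ + X]big1 ?addr0; last first.
    move=> i' ii'; apply: big1 => j _; rewrite /par /= ifN ?scaler0 //.
    by rewrite eq_sym -(inj_eq val_inj) in ii'.
  by apply: eq_bigr => j _; rewrite /par /= eqxx.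
have eS u : C u <-> exists c : T -> R, u = \sum_t c t *: e t.
  split => [[f ->]|[c ->]]; last first.
    by exists (fun i => \sum_t c t *: par t i); rewrite -code_word_sum.
  exists (fun t : T => coord (f t.1) t.2); rewrite -code_word_sum.
  apply: eq_code_word => // i il.
  by rewrite (sum_par _ (Ordinal il)) /= -coordE.
have eI (c : T -> R) : \sum_t c t *: e t = 0 -> forall t, c t = 0.
  rewrite -code_word_sum => /inj cE [i j].
  by apply: (bI (fun j => c (i, j))); rewrite -sum_par cE.
pose k := #|{: T}|.
pose e' (i : 'I_k) := e (enum_val i).
have e'S : generates e' C.
  move=> u; split => [/eS [c ->]|[c ->]].
    by exists (c \o enum_val); rewrite sum_enum_val.
  apply/eS; exists (c \o enum_rank); rewrite [RHS]sum_enum_val.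
  by apply: eq_bigr => i _; rewrite /= enum_valK.
have e'I : lin_indep e'.
  move=> c c0 i; rewrite -(enum_valK i); apply: (eI (c \o enum_rank)).
  rewrite sum_enum_val -[RHS]c0.
  by apply: eq_bigr => j _; rewrite /= enum_valK.
have kE : k = (l * n)%N by rewrite /k card_prod !card_ord.
have C_lin a u v : C u -> C v -> C (a *: u + v).
  move=> [f ->] [f' ->]; exists (fun i => a *: f i + f' i).
  by rewrite -code_wordP.
have C0 : C 0 by exists (fun=> 0); rewrite -[LHS]code_word0.
have [u [Cu u0 ukill]] : exists u, [/\ C u, u != 0 &
    forall j : 'I_n, (j < l.-1)%N -> skew_end act u (b j) = 0].
  pose w q := widen_ord (leq_trans (leq_pred l) ln) q : 'I_n.
  pose T' := ('I_l.-1 * 'I_n)%type.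
  pose A := \matrix_(i < k, q < #|{: T'}|)
    coord (skew_end act (e' i) (b (w (enum_val q).1))) (enum_val q).2.
  (* l n coefficients, subject to the (l - 1) n equations u (b j) = 0. *)
  have [|v v0 vA] := left_kernel_wide A.
    rewrite kE card_prod !card_ord ltn_pmul2r ?prednK //.
    exact: leq_trans l0 ln.
  exists (\sum_i v 0 i *: e' i); split.
  - by apply/e'S; exists (v 0).
  - apply: contraNneq v0 => /e'I v0; apply/eqP/rowP => i.
    by rewrite mxE v0.
  - move=> j jl; rewrite skew_end_suml.
    under eq_bigr => i _ do
      rewrite [skew_end act _ _]coordE scaler_sumr.
    rewrite exchange_big big1 //= => j' _.
    under eq_bigr => i _ do rewrite scalerA.
    rewrite -scaler_suml.
    have /rowP /(_ (enum_rank (Ordinal jl, j'))) := vA; rewrite !mxE => E.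
    rewrite [X in X *: _](_ : _ = 0) ?scale0r // -[RHS]E.
    apply: eq_bigr => i _; rewrite !mxE enum_rankK /=.
    by congr (_ * coord (skew_end _ _ (b _)) _); apply: val_inj.
have nE : (l.-1 + (n - l + 1))%N = n.
  by rewrite addn1 addnS -addSn prednK // subnKC.
have uR : generates (fun i => skew_end act u (b (cast_ord nE (rshift l.-1 i))))
    (range (skew_end act u)).
  move=> x; split => [[y _ <-]|[c ->]]; last first.
    exists (\sum_i c i *: b (cast_ord nE (rshift l.-1 i))) => //.
    by rewrite skew_end_sumr.
  exists (fun i => coord y (cast_ord nE (rshift l.-1 i))).
  rewrite [y in LHS]coordE skew_end_sumr (reindex (cast_ord nE)) /=; last first.
    apply: onW_bij; exists (cast_ord (esym nE)).
      exact: cast_ordK.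
    exact: cast_ordKV.
  rewrite big_split_ord /= big1 ?add0r // => i _.
  by rewrite ukill ?scaler0 /=.
have rank_lb v : C v -> v != 0 -> (n - l + 1 <= rk_inn_skew act v)%N.
  move=> [f vE] v0.
  have gS : exists r, exists w : 'I_r -> S, generates w (range (skew_end act v)).
    exists n, (fun j => skew_end act v (b j)) => x; split => [[y _ <-]|[c ->]].
      by exists (coord y); rewrite [y in LHS]coordE skew_end_sumr.
    by exists (\sum_j c j *: b j) => //; rewrite skew_end_sumr.
  have [[w wS] _] := min_natP gS.
  rewrite -/(rk_inn _) in w wS.
  suff : (n < rk_inn_skew act v + l)%N.
    by rewrite addn1 -subSn // leq_subLR addnC.
  apply: (key f _ w); last by rewrite -[code_word f]vE.
  apply: contrapT => nf; move/eqP: v0; apply.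
  rewrite vE -[RHS]code_word0; apply: eq_code_word => // i il.
  by apply/eqP; apply: contraT => fi; case: nf; exists i.
have distE : min_dist act C = (n - l + 1)%N.
  apply: min_nat_eq; last by move=> j [v [Cv v0 ->]]; exact: rank_lb.
  exists u; split => //; apply/eqP; rewrite eqn_leq rank_lb //=.
  apply: (min_natP _).2; last by eexists; exact: uR.
  by exists (n - l + 1)%N; eexists; exact: uR.
split.
- split; last by exists u.
  split; first by rewrite inE.
  by move=> a x y /set_mem Cx /set_mem Cy; apply/mem_set/C_lin.
- by exists k, e'.
- rewrite -/C (rk_inn_free e'S e'I) distE gTn kE mulnC; congr (_ * _)%N.
  by rewrite subnDA subKn // subnK.
Qed.

End Code.

(** * Maximal ideals *)

Section MaximalIdeals.
Variables (A : comNzRingType) (I : {pred A}).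
Hypothesis maxI : is_maximal_ideal I.

Lemma maximal_comaximal x :
  x \notin I -> exists2 a, a \in I & exists b, 1 = a + b * x.
Proof.
move=> xI; have [[I0 I1 Ilin] Imax] := maxI.
pose J : {pred A} :=
  fun y => `[< exists2 a, a \in I & exists b, y = a + b * x >].
have [/asboolP //|J1] := boolP (1 \in J).
have JI : J =i I.
  apply: Imax => [|y yI]; last first.
    by apply/asboolP; exists y => //; exists 0; rewrite mul0r addr0.
  split => //.
    by apply/asboolP; exists 0 => //; exists 0; rewrite mul0r addr0.
  move=> c _ _ /asboolP [a aI [b ->]] /asboolP [a' aI' [b' ->]].
  apply/asboolP; exists (c * a + a'); first exact: Ilin.
  by exists (c * b + b'); rewrite mulrDr mulrDl mulrA addrACA.
suff : x \in I by rewrite (negPf xI).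
by rewrite -JI; apply/asboolP; exists 0 => //; exists 1; rewrite add0r mul1r.
Qed.

Lemma maximal_prime x y : x * y \in I -> x \in I \/ y \in I.
Proof.
move=> xyI; have [[I0 _ Ilin] _] := maxI.
have [xI|xI] := boolP (x \in I); [by left|right].
have [a aI [b ab]] := maximal_comaximal xI.
have -> : y = y * a + b * (x * y).
  by rewrite -[LHS]mul1r ab mulrDl -mulrA [y * a]mulrC.
apply: (Ilin) => //; rewrite -[b * _]addr0; exact: Ilin.
Qed.

Lemma maximal_expr x k : x ^+ k \in I -> x \in I.
Proof.
elim: k => [|k IH]; first by rewrite expr0 => I1; case: maxI => [[_ /negP]].
by rewrite exprS => /maximal_prime [|/IH].
Qed.

End MaximalIdeals.

(** Zorn's lemma puts every non-unit in some maximal ideal. *)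
Lemma unit_outside_unique_maximal (A : comNzRingType) (I : {pred A}) x :
  (forall J, is_maximal_ideal J -> J =i I) -> x \notin I -> exists y, y * x = 1.
Proof.
move=> uniqI xI; apply: contrapT => xnu; move/negP: xI; apply.
pose ideal (X : set A) := ~ X 1 /\ forall a u v, X u -> X v -> X (a * u + v).
(* Zorn_bigcup also asks for the union of the empty chain, hence set0. *)
pose P (X : set A) := X = set0 \/ X x /\ ideal X.
have [F FP Ftot|X [PX Xmax]] := @Zorn_bigcup A P.
  have [[X FX X0]|F0] := pselect (exists2 X, F X & X !=set0); last first.
    left; rewrite -subset0 => y [X FX Xy].
    by apply: F0; exists X => //; exists y.
  have FI Y : F Y -> Y !=set0 -> Y x /\ ideal Y.
    by move=> FY [y Yy]; case: (FP Y FY) => // Y0; rewrite Y0 in Yy.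
  right; split; first by exists X => //; case: (FI X FX X0).
  split=> [[Y FY Y1]|a u v [Y FY Yu] [Z FZ Zv]].
    have [_ [/(_ Y1)]] // := FI Y FY (ex_intro _ _ Y1).
  have [_ [_ Ylin]] := FI Y FY (ex_intro _ _ Yu).
  have [_ [_ Zlin]] := FI Z FZ (ex_intro _ _ Zv).
  have [YZ|ZY] := Ftot Y Z FY FZ.
    by exists Z => //; apply: Zlin => //; exact: YZ.
  by exists Y => //; apply: Ylin => //; exact: ZY.
have idealx : ideal [set y | exists b, y = b * x].
  split=> [[b /esym bx]|a _ _ [b ->] [b' ->]]; first by apply: xnu; exists b.
  by exists (a * b + b'); rewrite mulrDl mulrA.
case: PX => [X0|[Xx [X1 Xlin]]].
  case: (Xmax [set y | exists b, y = b * x]); last first.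
    by right; split => //; exists 1; rewrite mul1r.
  rewrite X0; split=> [y []|/(_ x)].
  by apply; exists 1; rewrite mul1r.
have X0 : X 0 by have := Xlin (-1) x x Xx Xx; rewrite mulN1r addNr.
have <- : [in X] =i I; last by rewrite inE.
apply: uniqI; split.
  split; [by rewrite inE|by apply/negP; rewrite inE|].
  by move=> a u v; rewrite !inE; exact: Xlin.
move=> K [K0 K1 Klin] XK y; apply/idP/idP; last exact: XK.
move=> yK; rewrite inE; apply: contrapT => nXy.
apply: (Xmax [set z | z \in K]).
  by split=> [z Xz|/(_ y yK)] //; apply: XK; rewrite inE.
right; split; first by apply: XK; rewrite inE.
by split; [exact/negP|move=> a u v uK vK; exact: Klin].
Qed.

Lemma principalP (A : comNzRingType) (a x : A) :
  reflect (exists b, x = b * a) (x \in principal a).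
Proof. exact: asboolP. Qed.

(** As p w is nilpotent, the maximal ideal m contains it, so the preimage of m
    is a proper ideal containing the maximal ideal (w). *)
Lemma maximal_preimage (A B : comNzRingType) (p : {rmorphism A -> B}) (w : A)
    (k : nat) (m : {pred B}) :
  is_maximal_ideal (principal w) -> is_maximal_ideal m -> p (w ^+ k) = 0 ->
  forall x, (p x \in m) = (x \in principal w).
Proof.
move=> [wideal wmax] mmax pwk x.
have [[m0 m1 mlin] _] := mmax.
have pw : p w \in m by apply: (maximal_expr mmax (k := k)); rewrite -rmorphXn pwk.
apply: (wmax [pred x | p x \in m]) => [|_ /principalP [b ->]].
  split; rewrite ?inE ?rmorph0 ?rmorph1 // => a u v; rewrite !inE => pu pv.
  by rewrite rmorphD rmorphM; exact: mlin.
by rewrite inE rmorphM -[_ * _]addr0; exact: mlin.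
Qed.

Section QuotientMorphism.
Variables (A : comNzRingType) (m : idealr A).

Lemma pi_ideal_eq0 x : (\pi_{ideal_quot m} x == 0) = (x \in m).
Proof. by rewrite -[x in RHS]subr0 Quotient.idealrBE [\pi 0]rmorph0. Qed.

Lemma quot_dom : (forall x y : A, x * y \in m -> x \in m \/ y \in m) ->
  forall x y : {ideal_quot m}, x * y = 0 -> x = 0 \/ y = 0.
Proof.
move=> mprime x y; rewrite -[x]reprK -[y]reprK -rmorphM => /eqP.
rewrite pi_ideal_eq0 => /mprime [] H; [left|right];
  by apply/eqP; rewrite pi_ideal_eq0.
Qed.

End QuotientMorphism.

Section QuotientEndomorphism.
Variables (R : comNzRingType) (A : comAlgType R) (m : idealr A).
Variable f : {rmorphism A -> A}.
Hypothesis mf : forall x, x \in m -> f x \in m.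

Lemma quot_map_pi x : quot_map f (\pi_{ideal_quot m} x) = \pi_{ideal_quot m} (f x).
Proof.
apply/eqP; rewrite -subr_eq0 /quot_map -rmorphB pi_ideal_eq0 -rmorphB.
by apply: mf; rewrite -pi_ideal_eq0 rmorphB /= reprK subrr.
Qed.

(** Carrying the proof that m is stable under f lets the ring morphism
    structure be inferred from the term. *)
Definition quot_endo (_ : forall x, x \in m -> f x \in m) :
  {ideal_quot m} -> {ideal_quot m} := quot_map f.

Lemma quot_endo_additive : zmod_morphism (quot_endo mf).
Proof.
move=> x y; rewrite -[x]reprK -[y]reprK -rmorphB /quot_endo !quot_map_pi.
by rewrite !rmorphB.
Qed.

Lemma quot_endo_multiplicative : monoid_morphism (quot_endo mf).
Proof.
split.
  by rewrite -(rmorph1 (\pi_{ideal_quot m})) /quot_endo quot_map_pi !rmorph1.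
move=> x y; rewrite -[x]reprK -[y]reprK -rmorphM /quot_endo !quot_map_pi.
by rewrite !rmorphM.
Qed.

HB.instance Definition _ := GRing.isZmodMorphism.Build _ _
  (quot_endo mf) quot_endo_additive.
HB.instance Definition _ := GRing.isMonoidMorphism.Build _ _
  (quot_endo mf) quot_endo_multiplicative.
End QuotientEndomorphism.

(** * Dual bases of Galois extensions *)

(** The matrices (g (b j))_(g, j) and (E j g)_(j, g) are inverse to each other.
    For an extension this says that b is a basis of S over the fixed ring, but
    in a form that every equivariant ring morphism preserves. *)
Definition dual_basis (gT : finGroupType) (S : comNzRingType)
    (act : gT -> S -> S) (n : nat) (b : 'I_n -> S) (E : 'I_n -> gT -> S) : Prop :=
  (forall j k, \sum_g E j g * act g (b k) = (j == k)%:R) /\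
  (forall g h, \sum_j act g (b j) * E j h = (g == h)%:R).

Section GaloisDualBasis.
Variables (gT : finGroupType) (R : comNzRingType) (S : comAlgType R).
Variable act : gT -> {lrmorphism S -> S}.
Hypothesis galS : is_galois act.

Let actM g h x : act (g * h)%g x = act g (act h x).
Proof. by case: galS => [[]]. Qed.

(** The pairs come from a preimage of the indicator function of 1 under the
    Galois map, and the other indicator functions are its translates. *)
Lemma galois_pairs : exists (N : nat) (x y : 'I_N -> S),
  forall g h, \sum_i act g (x i) * act h (y i) = (g == h)%:R.
Proof.
have [[act1 _ _] _ _ [inv _ invK]] := galS.
pose t := generic_quotient.repr (inv [ffun g => (g == 1%g)%:R]).
have tE g : \sum_(p <- t) p.1 * act g p.2 = (g == 1%g)%:R.
  have /ffunP /(_ g) := invK [ffun g => (g == 1%g)%:R].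
  by rewrite /galois_map !ffunE.
exists (size t), (fun i => (nth (0, 0) t i).1), (fun i => (nth (0, 0) t i).2).
move=> g h; have := congr1 (act g) (tE (g^-1 * h)%g).
rewrite rmorph_nat -eq_invg_mul invgK => <-.
rewrite (big_nth (0, 0)) big_mkord rmorph_sum.
by apply: eq_bigr => i _; rewrite rmorphM /= -actM mulKVg.
Qed.

(** Over the local ring S some full-height minor of (g (x i)) is a unit, because
    that matrix has a right inverse over the residue field. *)
Lemma galois_dual_basis (I : {pred S}) :
  is_maximal_ideal I -> (forall J, is_maximal_ideal J -> J =i I) ->
  exists (b : 'I_#|gT| -> S) E, dual_basis act b E.
Proof.
move=> maxI uniqI; have [N [x [y xyE]]] := galois_pairs.
pose X := \matrix_(i < #|gT|, j < N) act (enum_val i) (x j).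
pose Y := \matrix_(j < N, i < #|gT|) act (enum_val i) (y j).
have XY : X *m Y = 1%:M.
  apply/matrixP => i j; rewrite !mxE -(inj_eq enum_val_inj) -xyE.
  by apply: eq_bigr => k _; rewrite !mxE.
pose I' : idealr S := HB.pack I (isIdealr.Build S I maxI.1).
have [c cU] : exists c, \det (colsub c X) \notin I.
  apply: contrapT => /forallNP minI.
  have [|v v0 vX] := left_kernel (M := map_mx (\pi_{ideal_quot I'}) X).
    move=> c; rewrite -map_mxsub det_map_mx; apply/eqP; rewrite pi_ideal_eq0.
    by have /negP/negPn := minI c.
  move/eqP: v0; apply; rewrite -[v]mulmx1 -(map_mx1 (\pi_{ideal_quot I'})).
  by rewrite -XY map_mxM mulmxA vX mul0mx.
have [e eU] := unit_outside_unique_maximal uniqI cU.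
pose B := colsub c X; pose E := e *: \adj B.
have EB : E *m B = 1%:M by rewrite -scalemxAl mul_adj_mx scale_scalar_mx eU.
have BE : B *m E = 1%:M by rewrite -scalemxAr mul_mx_adj scale_scalar_mx eU.
exists (fun j => x (c j)), (fun j g => E j (enum_rank g)); split.
  move=> j k; have /matrixP /(_ j k) := EB; rewrite !mxE => <-.
  rewrite (reindex (@enum_val gT gT)) /=; last exact/onW_bij/enum_val_bij.
  by apply: eq_bigr => i _; rewrite enum_valK !mxE.
move=> g h; have /matrixP /(_ (enum_rank g) (enum_rank h)) := BE.
rewrite !mxE (inj_eq enum_rank_inj) => <-.
by apply: eq_bigr => j _; rewrite !mxE enum_rankK.
Qed.

(** The coordinates of x are the unique solution c of the equations
    sum_j g (b j) * c j = g x; the group permutes these equations, so it fixes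
    c. *)
Lemma dual_basis_span n (b : 'I_n -> S) E x :
  dual_basis act b E -> exists c : 'I_n -> R, x = \sum_j c j *: b j.
Proof.
move=> [EB BE]; have [[act1 _ _] _ fixS _] := galS.
pose c j := \sum_g E j g * act g x.
have cE g : \sum_j act g (b j) * c j = act g x.
  under eq_bigr => j _ do rewrite mulr_sumr.
  rewrite exchange_big /= (bigD1 g) //= [X in _ + X]big1 ?addr0.
    under eq_bigr => j _ do rewrite mulrA.
    by rewrite -mulr_suml BE eqxx mul1r.
  move=> h hg; under eq_bigr => j _ do rewrite mulrA.
  by rewrite -mulr_suml BE eq_sym (negPf hg) mul0r.
have cfix h j : act h (c j) = c j.
  have hcE g : \sum_j act g (b j) * act h (c j) = act g x.
    have := congr1 (act h) (cE (h^-1 * g)%g); rewrite -actM mulKVg => <-.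
    by rewrite rmorph_sum; apply: eq_bigr => k _; rewrite rmorphM /= -actM mulKVg.
  rewrite [RHS]/c; under [RHS]eq_bigr => g _ do rewrite -hcE mulr_sumr.
  rewrite exchange_big /= (bigD1 j) //= [X in _ = _ + X]big1 ?addr0.
    under [RHS]eq_bigr => g _ do rewrite mulrA.
    by rewrite -mulr_suml EB eqxx mul1r.
  move=> k kj; under eq_bigr => g _ do rewrite mulrA.
  by rewrite -mulr_suml EB eq_sym (negPf kj) mul0r.
have /fin_all_exists [a aE] j : exists a : R, c j = a%:A.
  by apply/fixS => h; exact: cfix.
exists a; rewrite -[x in LHS]act1 -cE; apply: eq_bigr => j _.
by rewrite act1 aE -scalerAr mulr1.
Qed.

End GaloisDualBasis.

Lemma dual_basis_morph (gT : finGroupType) (S S' : comNzRingType)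
    (act : gT -> S -> S) (act' : gT -> S' -> S') (p : {rmorphism S -> S'})
    n (b : 'I_n -> S) E :
  (forall g x, p (act g x) = act' g (p x)) ->
  dual_basis act b E -> dual_basis act' (p \o b) (fun j g => p (E j g)).
Proof.
move=> pact [EB BE]; split=> [j k|g h].
  rewrite -(rmorph_nat p) -EB rmorph_sum.
  by under [RHS]eq_bigr => g _ do rewrite rmorphM /= pact.
rewrite -(rmorph_nat p) -BE rmorph_sum.
by under [RHS]eq_bigr => j _ do rewrite rmorphM /= pact.
Qed.

Lemma dual_basis_indep (gT : finGroupType) (S : comNzRingType)
    (act : gT -> {rmorphism S -> S}) n (b : 'I_n -> S) E (c : 'I_n -> S) :
  dual_basis act b E -> (forall g j, act g (c j) = c j) ->
  \sum_j c j * b j = 0 -> forall j, c j = 0.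
Proof.
move=> [EB _] cfix cb j.
have cg g : \sum_k c k * act g (b k) = 0.
  rewrite -[RHS](rmorph0 (act g)) -[X in _ = act g X]cb rmorph_sum.
  by apply: eq_bigr => k _; rewrite rmorphM /= cfix.
transitivity (\sum_k c k * (j == k)%:R).
  rewrite (bigD1 j) //= eqxx mulr1 big1 ?addr0 // => k kj.
  by rewrite eq_sym (negPf kj) mulr0.
under eq_bigr => k _ do rewrite -EB mulr_sumr.
rewrite exchange_big big1 //= => g _.
under eq_bigr => k _ do rewrite mulrCA.
by rewrite -mulr_sumr cg mulr0.
Qed.

(** * Rank bounds in a domain quotient *)

Section CyclicAction.
Variables (gT : finGroupType) (s : gT).
Hypothesis s_gen : forall g : gT, g \in <[s]>%g.

Let order_s : #[s]%g = #|gT|.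
Proof. by rewrite -cardsT; apply: eq_card => g; rewrite inE s_gen. Qed.

Lemma expg_card_gen : (s ^+ #|gT| = 1)%g.
Proof. by rewrite -order_s expg_order. Qed.

Lemma expg_ord_bij : bijective (fun i : 'I_#|gT| => (s ^+ i)%g).
Proof.
apply: inj_card_bij; last by rewrite card_ord.
move=> i j /eqP; rewrite eq_expg_mod_order order_s !modn_small //.
by move=> /eqP /val_inj.
Qed.

Variables (S : comNzRingType) (act : gT -> {rmorphism S -> S}).
Hypothesis act1 : forall x, act 1%g x = x.
Hypothesis actM : forall g h x, act (g * h)%g x = act g (act h x).

Lemma iter_act i x : iter i (act s) x = act (s ^+ i)%g x.
Proof. by elim: i => [|i IH]; rewrite ?expg0 ?act1 //= IH -actM -expgS. Qed.

Lemma cyc_norm_act x : cyc_norm (act s) #|gT| x = \prod_g act g x.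
Proof.
rewrite [RHS](reindex (fun i : 'I_#|gT| => (s ^+ i)%g)) /=.
  by apply: eq_bigr => i _; rewrite iter_act.
exact/onW_bij/expg_ord_bij.
Qed.

Lemma prod_act g x : \prod_k act k (act g x) = \prod_k act k x.
Proof.
rewrite [RHS](reindex_inj (mulIg g)) /=.
by apply: eq_bigr => k _; rewrite actM.
Qed.

End CyclicAction.

Section RankModulo.
Variables (gT : finGroupType) (s : gT) (R : comNzRingType) (S : comAlgType R).
Variables (act : gT -> {lrmorphism S -> S}) (D : comNzRingType).
Variables (actD : gT -> {rmorphism D -> D}) (p : {rmorphism S -> D}).
Hypothesis s_gen : forall g : gT, g \in <[s]>%g.
Hypothesis act1 : forall x, act 1%g x = x.
Hypothesis actM : forall g h x, act (g * h)%g x = act g (act h x).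
Hypothesis domD : forall x y : D, x * y = 0 -> x = 0 \/ y = 0.
Hypothesis p_surj : forall y, exists x, p x = y.
Hypothesis p_act : forall g x, p (act g x) = actD g (p x).

(** Used with p the identity of S over a discrete valuation ring, and with p
    the projection onto the residue field of S over its proper quotients. *)
Lemma code_word_rank_bound (b : 'I_#|gT| -> S) E (l : nat) (eta : S) (h : int)
    (f : nat -> S) r (A : 'I_#|gT| -> 'I_r -> R) (v : 'I_r -> S) :
  dual_basis act b E -> (0 < l)%N ->
  p (galois_norm act eta) <> (-1) ^+ (l * #|gT|) ->
  (exists2 i, (i < l)%N & p (f i) != 0) ->
  (forall j, p (skew_end act (code_word s act l eta h f) (b j))
             = p (\sum_k A j k *: v k)) ->
  (#|gT| < r + l)%N.
Proof.
move=> bE l0 Neta [i0 i0l fi0] fb; rewrite ltnNge; apply/negP => rl.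
have actD1 y : actD 1%g y = y by have [x <-] := p_surj y; rewrite -p_act act1.
have actDM g k y : actD (g * k)%g y = actD g (actD k y).
  by have [x <-] := p_surj y; rewrite -!p_act actM.
have n0 : (0 < #|gT|)%N by apply/card_gt0P; exists 1%g.
have sgn y : iter #|gT| (actD s) y = y.
  by rewrite (iter_act s actD1 actDM) (expg_card_gen s_gen) actD1.
have normD x : cyc_norm (actD s) #|gT| (p x) = p (galois_norm act x).
  rewrite (cyc_norm_act s_gen actD1 actDM) rmorph_prod.
  by apply: eq_bigr => g _; rewrite p_act.
have bD : indep_over_fixed (actD s) (p \o b).
  move=> c cfix; apply: (dual_basis_indep (dual_basis_morph p_act bE)) => g j.
  have /cycleP [i ->] := s_gen g.
  by rewrite -(iter_act s actD1 actDM); elim: i => //= i ->.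
(* The coefficient of s ^ l, which code_word derives from f 0. *)
pose f' i := if i == l then eta * act (expgz s h) (f 0%N) else f i.
have f'E i : (i < l)%N -> f' i = f i by rewrite /f'; case: ltngtP.
apply: (@skew_poly_rank_bound _ _ _ domD n0 sgn (p \o b) l r (p \o f') (p eta)
  (p (act (expgz s h) (f 0%N))) (\matrix_(j, k) p (A j k)%:A) (p \o v)) => //.
- by exists i0 => //=; rewrite f'E.
- by rewrite /= /f' eqxx rmorphM.
- rewrite !normD f'E //; congr (p _).
  exact: (@prod_act _ _ (fun g => act g : {rmorphism S -> S})).
- by rewrite normD.
- by move=> i j; rewrite mxE -p_act linearZ /= rmorph1.
- move=> j; under [RHS]eq_bigr => k _ do rewrite mxE -rmorphM mulr_algl.
  rewrite -rmorph_sum -fb skew_end_code_word rmorphD rmorph_sum.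
  rewrite big_ord_recr /= /f' eqxx (iter_act s actD1 actDM) -p_act -rmorphM.
  congr (_ + _); apply: eq_bigr => i _.
  by rewrite -/(f' i) f'E // (iter_act s actD1 actDM) -p_act -rmorphM.
Qed.

End RankModulo.

(** * Unramified extensions *)

(** A basis of St over Rt with unit determinant (g (b j)) maps to a basis of S
    over R.  The coordinates in R are unique because R embeds into S: if
    a = x * d in St with a in Rt, then x is fixed by the group, so a is a
    multiple of d in Rt.  The quotient by a zero ideal is included as d = 0. *)
Lemma unramified_free (gT : finGroupType)
    (Rt : comNzRingType) (St : comAlgType Rt) (actt : gT -> {lrmorphism St -> St})
    (R : comNzRingType) (S : comAlgType R) (act : gT -> {lrmorphism S -> S})
    (pR : {rmorphism Rt -> R}) (pS : {rmorphism St -> S}) (d : Rt) (I : {pred St}) :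
  (forall x y : St, x * y = 0 -> x = 0 \/ y = 0) -> is_galois actt ->
  is_maximal_ideal I -> (forall J, is_maximal_ideal J -> J =i I) ->
  is_quotient_extension actt act pR pS (principal d) (principal (d%:A : St)) ->
  [/\ forall x, act 1%g x = x,
      forall g h x, act (g * h)%g x = act g (act h x)
    & exists (b : 'I_#|gT| -> S) E, [/\ dual_basis act b E,
        forall x : S, exists c : 'I_#|gT| -> R, x = \sum_j c j *: b j
      & lin_indep b]].
Proof.
move=> domSt galt maxI uniqI [[pR_surj pR0] [pS_surj pS0] pA p_act].
have [[act1 actM _] injA fixA _] := galt.
have [bt [Et btE]] := galois_dual_basis galt maxI uniqI.
have bE := dual_basis_morph (act' := fun g => act g) p_act btE.
split.
- by move=> x; have [y <-] := pS_surj x; rewrite -p_act act1.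
- by move=> g h x; have [y <-] := pS_surj x; rewrite -!p_act actM.
exists (pS \o bt), (fun j g => pS (Et j g)); split=> //.
  move=> x; have [y <-] := pS_surj x.
  have [c ->] := dual_basis_span galt y btE; exists (pR \o c).
  rewrite rmorph_sum; apply: eq_bigr => j _.
  by rewrite -mulr_algl rmorphM /= pA mulr_algl.
move=> c cb j.
have cA : (c j)%:A = 0 :> S.
  apply: (@dual_basis_indep _ _ (fun g => act g : {rmorphism S -> S}) _ _ _
    (fun j => (c j)%:A) bE) => [g k|].
    by have := linearZ_LR (act g) (c k) 1; rewrite rmorph1.
  by under eq_bigr => k _ do rewrite mulr_algl.
have [a aE] := pR_surj (c j).
move: cA; rewrite -aE -pA => /pS0 /principalP [x xd].
apply/pR0/principalP.
have [d0|d0] := eqVneq d 0.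
  exists 0; rewrite mul0r; apply: injA.
  by rewrite xd d0 scale0r mulr0.
suff [e xe] : exists e : Rt, x = e%:A.
  exists e; apply: injA; rewrite xd xe -scalerAl mul1r scalerA; exact: erefl.
apply/fixA => g; apply/eqP; rewrite -subr_eq0; apply/eqP.
have gxd : actt g x * d%:A = x * d%:A.
  have actA c1 : actt g c1%:A = c1%:A by rewrite linearZ /= rmorph1.
  by rewrite -[in LHS]actA -rmorphM /= -xd actA.
have /domSt [//|dA0] : (actt g x - x) * d%:A = 0 by rewrite mulrBl gxd subrr.
by case/eqP: d0; apply: injA; rewrite dA0 scale0r.
Qed.

(** Every element has a w-adic expansion with k digits among representatives
    of the finitely many residue classes. *)
Lemma nilpotent_finite (A : comNzRingType) (m : idealr A) (w : A) (k : nat) :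
  w ^+ k = 0 -> (forall x, x \in m -> exists y, x = w * y) ->
  finite_set [set: {ideal_quot m}] -> finite_set [set: A].
Proof.
move=> wk mw /finite_seqP [L LE].
pose T := [seq generic_quotient.repr q | q <- L].
have TP x : exists2 t, t \in T & exists y, x = t + w * y.
  exists (generic_quotient.repr (\pi_{ideal_quot m} x)).
    apply: map_f; have : [set: {ideal_quot m}] (\pi_{ideal_quot m} x) by [].
    by rewrite LE.
  have [|y xy] := mw (x - generic_quotient.repr (\pi_{ideal_quot m} x)).
    by rewrite -pi_ideal_eq0 rmorphB /= reprK subrr.
  by exists y; rewrite -xy addrC subrK.
have digits i : exists Li : seq A, forall x,
    exists2 t, t \in Li & exists y, x = t + w ^+ i * y.
  elim: i => [|i [Li LiP]].
    by exists [:: 0] => x; exists 0; rewrite ?inE //; exists x; rewrite add0r mul1r.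
  exists [seq a + w ^+ i * t | a <- Li, t <- T] => x.
  have [a aL [y ->]] := LiP x; have [t tT [z ->]] := TP y.
  exists (a + w ^+ i * t); first by apply: allpairs_f.
  by exists z; rewrite mulrDr addrA exprSr mulrA.
have [Lk LkP] := digits k.
apply/finite_seqP; exists Lk; apply/seteqP; split=> x //= _.
by have [t tL [y ->]] := LkP x; rewrite wk mul0r addr0.
Qed.

Lemma dvr_uniformizer_neq0 (A : comNzRingType) (w : A) :
  is_dvr A -> is_maximal_ideal (principal w) -> w != 0.
Proof.
move=> [_ _ _ [x [x0 xnu]]] maxw; apply/eqP => w0.
have [|_ /principalP [c ->] [b]] := maximal_comaximal maxw (x := x).
  by apply/principalP => -[b]; rewrite w0 mulr0 => x0'; rewrite x0' eqxx in x0.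
by rewrite w0 mulr0 add0r mulrC => /esym /xnu.
Qed.

(** The powers of w are distinct. *)
Lemma domain_nonunit_infinite (A : comNzRingType) (w : A) :
  (forall x y : A, x * y = 0 -> x = 0 \/ y = 0) -> w != 0 ->
  (forall y, y * w <> 1) -> ~ finite_set [set: A].
Proof.
move=> domA w0 wnu /finite_seqP [L LE].
have wi0 i : w ^+ i != 0.
  elim: i => [|i IH]; rewrite ?oner_eq0 // exprS.
  by apply/eqP => /domA [] /eqP; apply/negP.
have wI i j : (i < j)%N -> w ^+ i != w ^+ j.
  move=> ij; apply/eqP => wij.
  have /domA [/eqP|] : w ^+ i * (1 - w ^+ (j - i)) = 0.
    by rewrite mulrBr mulr1 -exprD subnKC ?(ltnW ij) // wij subrr.
    by rewrite (negPf (wi0 i)).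
  rewrite -[(j - i)%N]prednK ?subn_gt0 // exprSr => /eqP.
  by rewrite subr_eq0 => /eqP /esym; exact: wnu.
have uniqw : uniq [seq w ^+ i | i <- iota 0 (size L).+1].
  rewrite map_inj_uniq ?iota_uniq // => i j wij.
  by case: (ltngtP i j) => // /wI; rewrite wij eqxx.
suff sub : {subset [seq w ^+ i | i <- iota 0 (size L).+1] <= L}.
  by have := uniq_leq_size uniqw sub; rewrite size_map size_iota ltnn.
by move=> x _; have : [set: A] x by []; rewrite LE.
Qed.

Lemma code_word_mul (gT : finGroupType) (s : gT) (R : comNzRingType)
    (S : comAlgType R) (act : gT -> {lrmorphism S -> S}) l eta h (a : S)
    (f : nat -> S) x : (forall g, act g a = a) ->
  skew_end act (code_word s act l eta h (fun i => a * f i)) x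
  = a * skew_end act (code_word s act l eta h f) x.
Proof.
move=> afix; rewrite !skew_end_code_word mulrDr mulr_sumr rmorphM /= afix.
rewrite mulrCA -!mulrA; congr (_ + _).
by apply: eq_bigr => i _; rewrite mulrA.
Qed.

(** Factor out the largest power of w dividing all the f i with i < l; it is
    bounded because w is nilpotent and some f i is nonzero. *)
Lemma extract_power (A : comNzRingType) (m : {pred A}) (w : A) (k l : nat)
    (f : nat -> A) :
  w ^+ k = 0 -> (forall x, x \in m -> exists y, x = w * y) ->
  (exists2 i, (i < l)%N & f i != 0) ->
  exists j f', [/\ (j < k)%N, forall i, (i < l)%N -> f i = w ^+ j * f' i
    & exists2 i, (i < l)%N & f' i \notin m].
Proof.
move=> wk mw [i0 i0l fi0].
pose P j := `[< exists f', forall i, (i < l)%N -> f i = w ^+ j * f' i >].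
have exP : exists j, P j.
  by exists 0%N; apply/asboolP; exists f => i _; rewrite mul1r.
have jk j : P j -> (j < k)%N.
  move=> /asboolP [f' f'E]; rewrite ltnNge; apply: contra fi0 => kj.
  by rewrite f'E // -(subnKC kj) exprD wk !mul0r.
case: (ex_maxnP exP (fun j Pj => ltnW (jk j Pj))) => j Pj jmax.
have [f' f'E] := asboolP _ Pj; exists j, f'; split=> //; first exact: jk.
apply: contrapT => f'm.
suff /jmax : P j.+1 by rewrite ltnn.
have /choice [f'' f''E] i : exists y, (i < l)%N -> f' i = w * y.
  case: (ltnP i l) => il; last by exists 0.
  have [|y ->] := mw (f' i); last by exists y.
  by apply: contrapT => /negP fim; apply: f'm; exists i.
apply/asboolP; exists f'' => i il.
by rewrite f'E // f''E // exprSr mulrA.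
Qed.

Theorem theorem2p29 (gT : finGroupType) (s : gT) (n : nat)
    (R : comNzRingType) (S : comAlgType R)
    (act : gT -> {lrmorphism S -> S})
    (mR : idealr R) (mS : idealr S) (l : nat) (h : int) (eta : S)
    (hG : forall g : gT, g \in <[s]>%g)
    (hn : #|gT| = n)
    (hRS : is_unramified_galois act)
    (hmR : is_maximal_ideal mR)
    (hmS : is_maximal_ideal mS)
    (hfin : finite_set [set: {ideal_quot mR}])
    (hl : (0 < l <= n)%N)
    (heta : eta != 0)
    (h1 : ~ finite_set [set: R] -> galois_norm act eta <> (-1) ^+ (l * n))
    (h2 : finite_set [set: R] ->
      residue_norm act (\pi_{ideal_quot mS} eta) <> (-1) ^+ (l * n)) :
  is_MRD act (twisted_code act s l eta h).
Proof.
move: hRS => [Rt [St [actt [w [pR [pS [[dvrR dvrS] galt maxw maxwS quo]]]]]]].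
have [domR _ _ _] := dvrR; have [domS _ [J0 [_ uniqS]] _] := dvrS.
have uniqwS J : is_maximal_ideal J -> J =i principal (w%:A : St).
  by move=> maxJ x; rewrite -(uniqS _ maxJ) (uniqS _ maxwS).
have w0 := dvr_uniformizer_neq0 dvrR maxw.
have wA0 := dvr_uniformizer_neq0 dvrS maxwS.
subst n; have [l0 ln] := andP hl.
have [d [k [quod dE]]] : exists d k,
    is_quotient_extension actt act pR pS (principal d) (principal (d%:A : St))
    /\ (d = 0 \/ (0 < k)%N /\ d = w ^+ k).
  case: quo => [quo|[k k0 quo]].
    by exists 0, 0%N; split; [rewrite scale0r|left].
  exists (w ^+ k), k; split; last by right.
  by move: quo; rewrite exprZn expr1n.
have [act1 actM [b [E [bE bS bI]]]] := unramified_free domS galt maxwS uniqwS quod.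
have [[pR_surj pR0] [pS_surj pS0] pA p_act] := quod.
apply: (MRD_of_rank_bound (b := b)) => // f r v f0 vf.
have /fin_all_exists [A AE] j : exists c : 'I_r -> R,
    skew_end act (code_word s act l eta h f) (b j) = \sum_q c q *: v q.
  by apply/vf; exists (b j).
(* d = 0: R is a discrete valuation ring. *)
case: dE => [d0|[k0 dE]].
  have inf : ~ finite_set [set: R].
    have pR_inj x : pR x = 0 -> x = 0.
      by move=> /pR0 /principalP [y ->]; rewrite d0 mulr0.
    apply: (domain_nonunit_infinite (w := pR w)).
    - move=> x y; have [x' <-] := pR_surj x; have [y' <-] := pR_surj y.
      by rewrite -rmorphM => /pR_inj /domR [] ->; [left|right]; rewrite rmorph0.
    - by apply: contraNneq w0 => /pR_inj ->.
    - move=> y; have [y' <-] := pR_surj y; rewrite -rmorphM => yw1.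
      have yw : y' * w = 1.
        apply/eqP; rewrite -subr_eq0; apply/eqP/pR_inj.
        by rewrite rmorphB rmorph1 yw1 subrr.
      case: maxw => [[_ /negP]] + _ _; apply.
      by apply/principalP; exists y'.
  apply: (@code_word_rank_bound _ s _ _ act S (fun g => act g) idfun hG act1 actM
    _ _ _ b E l eta h f r A v bE l0) => //; last exact: h1.
  - move=> x y; have [x' <-] := pS_surj x; have [y' <-] := pS_surj y.
    have pS_inj z : pS z = 0 -> z = 0.
      by move=> /pS0 /principalP [c ->]; rewrite d0 scale0r mulr0.
    by rewrite -rmorphM => /pS_inj /domS [] ->; [left|right]; rewrite rmorph0.
  - by move=> y; exists y.
have pRwk : pR (w ^+ k) = 0.
  by apply/pR0/principalP; exists 1; rewrite mul1r dE.
pose W : S := pS w%:A.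
have Wk : W ^+ k = 0.
  rewrite -rmorphXn exprZn expr1n; apply/pS0/principalP.
  by exists 1; rewrite mul1r dE.
(* Both maximal ideals are generated by the uniformizer. *)
have mRE := maximal_preimage maxw hmR pRwk.
have mSE : forall x, (pS x \in mS) = (x \in principal (w%:A : St)).
  by apply: (maximal_preimage maxwS hmS (k := k)); rewrite rmorphXn Wk.
have finR : finite_set [set: R].
  apply: (nilpotent_finite (m := mR) (w := pR w) (k := k)) => //.
    by rewrite -rmorphXn.
  move=> x; have [x' <-] := pR_surj x; rewrite mRE => /principalP [y ->].
  by exists (pR y); rewrite rmorphM mulrC.
have mSW x : x \in mS -> exists y, x = W * y.
  have [x' <-] := pS_surj x; rewrite mSE => /principalP [y ->].
  by exists (pS y); rewrite rmorphM mulrC.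
have Wfix g : act g W = W.
  by rewrite -p_act linearZ /= rmorph1.
have mS_act g x : x \in mS -> act g x \in mS.
  move=> /mSW [y ->]; rewrite rmorphM /= Wfix mulrC; apply: idealMr.
  by rewrite mSE; apply/principalP; exists 1; rewrite mul1r.
(* A relation multiplied by W ^ j can be divided by it modulo the maximal
   ideal. *)
have annW j x : (j < k)%N -> W ^+ j * x = 0 -> x \in mS.
  move=> jk; have [x' <-] := pS_surj x.
  rewrite -rmorphXn -rmorphM => /pS0 /principalP [y].
  rewrite dE mSE => xy; apply/principalP.
  exists (y * w%:A ^+ (k - j.+1)); apply/eqP; rewrite -subr_eq0; apply/eqP.
  have [|wj0|//] := domS (w%:A ^+ j) (x' - y * w%:A ^+ (k - j.+1) * w%:A).
    rewrite mulrBr xy -[y * _ * _]mulrA -exprSr subnSK // mulrCA -exprD.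
    by rewrite subnKC ?(ltnW jk) // exprZn expr1n subrr.
  exfalso; move/eqP: wA0; apply; elim: {x' y xy jk} j wj0 => [/eqP|j IH].
    by rewrite oner_eq0.
  by rewrite exprS => /domS [].
have [j [f' [jk f'E f'm]]] := extract_power Wk mSW f0.
have fE x : skew_end act (code_word s act l eta h f) x
    = W ^+ j * skew_end act (code_word s act l eta h f') x.
  rewrite -code_word_mul => [|g]; last by rewrite rmorphXn /= Wfix.
  by congr (skew_end _ _ _); apply: eq_code_word.
have /fin_all_exists [z zE] q : exists x,
    skew_end act (code_word s act l eta h f) x = v q.
  by have [x _ <-] := generates_mem q vf; exists x.
apply: (@code_word_rank_bound _ s _ _ act _
  (fun g => quot_endo (mS_act g) : {rmorphism _ -> _}) \pi_{ideal_quot mS}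
  hG act1 actM _ _ _ b E l eta h f' r A
  (fun q => skew_end act (code_word s act l eta h f') (z q)) bE l0) => //.
- exact/quot_dom/maximal_prime.
- by move=> y; exists (generic_quotient.repr y); exact: reprK.
- by move=> g x; rewrite /= /quot_endo quot_map_pi //; exact: mS_act.
- move=> N; apply: (h2 finR); rewrite -N /residue_norm rmorph_prod.
  by apply: eq_bigr => g _; rewrite quot_map_pi //; exact: mS_act.
- by case: f'm => i il fi; exists i => //; rewrite pi_ideal_eq0.
- move=> q; apply/eqP; rewrite -subr_eq0 -rmorphB pi_ideal_eq0.
  apply: (annW j) => //; rewrite mulrBr -fE AE mulr_sumr.
  apply/eqP; rewrite subr_eq0; apply/eqP; apply: eq_bigr => i _.
  by rewrite -scalerAr -fE zE.
Qed.
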